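(* Let $M$ be a connected binary matroid not isomorphic to $U_{1,1}$. Then $\mu(M)\le\eta(M)$.
   Context: Matroids are finite, and connected matroids are understood to have nonempty ground set. $U_{1,1}$ is the one-element rank-$1$ uniform matroid. A matroid is binary if it is representable over $GF(2)$. A join of a matroid $M$ on ground set $E(M)$ is a set $J\subseteq E(M)$ with $|J\cap C|\le |C|/2$ for every circuit $C$ of $M$. $\mu(M)$ is the maximum size of a join. Ear decompositions: for a nonempty sequence of circuits $C_1,\dots,C_t$ of $M$ put $D_0=\varnothing$ and $D_i=C_1\cup\dots\cup C_i$. The sequence is an ear decomposition of $M$ if $D_t=E(M)$ and for every $i\ge 2$: (E1) $C_i\cap D_{i-1}\neq\varnothing$; (E2) $C_i\setminus D_{i-1}\ne\varnothing$; (E3) no circuit $C$ of $M$ with $C\cap D_{i-1}\neq\varnothing$ and $C\setminus D_{i-1}\neq\varnothing$ has $C\setminus D_{i-1}$ properly contained in $C_i\setminus D_{i-1}$. The set $P_i=C_i\setminus D_{i-1}$ is the $i$th lobe; it is odd or even according to the parity of $|P_i|$. $\varphi(M)$ is the minimum number of even lobes over all ear decompositions of $M$. For a connected matroid $M$ not isomorphic to $U_{1,1}$, an ear decomposition exists, and $\eta(M):=\frac{r(M)+\varphi(M)}{2}$, where $r(M)$ is the rank. *)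

(* Defs.v *)
From HB Require Import structures.
From mathcomp Require Import all_boot all_order all_algebra.

Set Implicit Arguments.
Unset Strict Implicit.
Unset Printing Implicit Defensive.

Import GRing.Theory.

(* The ground set may be a proper subset of the carrier T, so that restrictions
   and minors of a matroid live on the same carrier. *)
Record matroid (T : finType) := Matroid {
  ground : {set T};
  indep : pred {set T};
  indep_sub_ground : forall X, indep X -> X \subset ground;
  indep0 : indep set0;
  indep_sub : forall X Y : {set T}, X \subset Y -> indep Y -> indep X;
  indep_aug : forall X Y : {set T}, indep X -> indep Y -> #|X| < #|Y| ->
    exists2 e, e \in Y :\: X & indep (e |: X)
}.

Section Matroids.

Variable T : finType.
Implicit Types (M : matroid T) (C D J X : {set T}) (s : seq {set T}).

Definition circuit M C : bool :=
  minset (fun X : {set T} => (X \subset ground M) && ~~ indep M X) C.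

Definition rank M : nat := \max_(X : {set T} | indep M X) #|X|.

Definition connected M : Prop :=
  ground M != set0 /\
  forall e f, e \in ground M -> f \in ground M -> e != f ->
    exists C, [/\ circuit M C, e \in C & f \in C].

(* v e is the column labelled by e. Since free is applied to the list of the
   columns v e for e in X, two equal columns are dependent. *)
Definition representable (F : fieldType) M : Prop :=
  exists (m : nat) (v : T -> 'cV[F]_m),
    forall X, X \subset ground M -> indep M X = free [seq v e | e in X].

Definition binary M : Prop := representable 'F_2 M.

Definition is_join M J : bool :=
  (J \subset ground M) &&
  [forall C : {set T}, circuit M C ==> (2 * #|J :&: C| <= #|C|)].

Definition mu M : nat := \max_(J : {set T} | is_join M J) #|J|.

(* A sequence C_1, ..., C_t is indexed from 0: nth set0 s i is C_(i+1),
   covered s i is D_i, and lobe s i is P_(i+1). *)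
Definition covered s (i : nat) : {set T} := \bigcup_(C <- take i s) C.

Definition lobe s (i : nat) : {set T} := nth set0 s i :\: covered s i.

Definition is_ear M D C : bool :=
  [&& C :&: D != set0,
      C :\: D != set0
    & [forall C' : {set T},
        [&& circuit M C', C' :&: D != set0 & C' :\: D != set0] ==>
        ~~ (C' :\: D \proper C :\: D)]].

Definition ear_decomposition M s : bool :=
  [&& s != [::],
      all (circuit M) s,
      covered s (size s) == ground M
    & [forall i : 'I_(size s),
        (0 < i) ==> is_ear M (covered s i) (nth set0 s i)]].

Definition even_lobes s : nat :=
  #|[set i : 'I_(size s) | ~~ odd #|lobe s i| ]|.

(* The minimum may be taken over sequences of length at most #|ground M|
   because lobes are nonempty and disjoint. phi_le and phi_attained show that
   phi is the minimum over all ear decompositions, of any length; the default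
   #|ground M| only matters if there is none, which ear_decomposition_exists
   excludes for a connected M not isomorphic to U_{1,1}. *)
Definition phi M : nat :=
  \big[minn/#|ground M|]_(s : #|ground M|.-bseq {set T} |
                            ear_decomposition M s) even_lobes s.

Definition eta M : rat := ((rank M + phi M)%:R / 2%:R)%R.

End Matroids.

(* The elements of the ground sets are matched as subtypes, so that the
   carriers outside the ground sets play no role. *)
Definition isomorphic (T T' : finType) (M : matroid T) (N : matroid T') : Prop :=
  exists f : {e : T | e \in ground M} -> {e : T' | e \in ground N},
    bijective f /\
    forall X : {set {e : T | e \in ground M}},
      indep M (val @: X) = indep N (val @: (f @: X)).

Section Uniform.

Variables r n : nat.

Definition uniform_indep : pred {set 'I_n} := fun X => #|X| <= r.

Lemma uniform_sub_ground X : uniform_indep X -> X \subset [set: 'I_n].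
Proof. by rewrite subsetT. Qed.

Lemma uniform_indep0 : uniform_indep set0.
Proof. by rewrite /uniform_indep cards0. Qed.

Lemma uniform_indep_sub (X Y : {set 'I_n}) :
  X \subset Y -> uniform_indep Y -> uniform_indep X.
Proof. by move=> /subset_leq_card; apply: leq_trans. Qed.

Lemma uniform_indep_aug (X Y : {set 'I_n}) :
  uniform_indep X -> uniform_indep Y -> #|X| < #|Y| ->
  exists2 e, e \in Y :\: X & uniform_indep (e |: X).
Proof.
move=> _ rY ltXY; have /set0Pn[e eYX] : Y :\: X != set0.
  rewrite setD_eq0; apply/negP => /subset_leq_card.
  by rewrite leqNgt ltXY.
exists e => //; move: eYX; rewrite inE => /andP[eX _].
by rewrite /uniform_indep cardsU1 eX; apply: leq_trans rY.
Qed.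

Definition uniform : matroid 'I_n :=
  Matroid uniform_sub_ground uniform_indep0 uniform_indep_sub uniform_indep_aug.

End Uniform.

Section PhiSpec.

Variable T : finType.
Implicit Types (M : matroid T) (s : seq {set T}).

Lemma circuit_neq0 M C : circuit M C -> C != set0.
Proof.
move=> /minsetP[/andP[_ dC] _]; apply: contraNneq dC => ->; exact: indep0.
Qed.

Lemma coveredS s i : i < size s ->
  covered s i.+1 = covered s i :|: nth set0 s i.
Proof.
by move=> lti; rewrite /covered (take_nth set0) // -cats1 big_cat /= big_seq1.
Qed.

Lemma ear_decomposition_size M s : ear_decomposition M s -> size s <= #|ground M|.
Proof.
case/and4P=> _ /allP cs /eqP <- /forallP es.
suff H i : i <= size s -> i <= #|covered s i| by apply: H.
elim: i => // i IHi lti; apply: leq_ltn_trans (IHi (ltnW lti)) _.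
apply: proper_card; rewrite coveredS // properE subsetUl subUset subxx /=.
rewrite -setD_eq0; case: i lti {IHi} => [|i] lti.
  rewrite /covered take0 big_nil setD0.
  by apply: circuit_neq0 (cs _ _); rewrite mem_nth.
by have /implyP/(_ isT)/and3P[] := es (Ordinal lti).
Qed.

Lemma bigminn_le_cond (I : finType) (P : pred I) (F : I -> nat) x0 i :
  P i -> \big[minn/x0]_(j | P j) F j <= F i.
Proof.
move=> Pi; rewrite unlock /=; have := mem_index_enum i.
elim: (index_enum I) => //= j r IHr; rewrite inE => /predU1P[<-|/IHr le_r].
  by rewrite Pi geq_minl.
by case: ifP => // _; apply: leq_trans (geq_minr _ _) le_r.
Qed.

Lemma phi_le M s : ear_decomposition M s -> phi M <= even_lobes s.
Proof.
move=> es; have ss := ear_decomposition_size es.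
pose B := #|ground M|.-bseq {set T}.
exact: (@bigminn_le_cond _ (fun s : B => ear_decomposition M s)
  (fun s : B => even_lobes s) _ (Bseq ss)).
Qed.

Lemma phi_attained M s0 : ear_decomposition M s0 ->
  exists2 s, ear_decomposition M s & even_lobes s = phi M.
Proof.
move=> es0; have ss0 := ear_decomposition_size es0.
suff: (exists2 s, ear_decomposition M s & even_lobes s = phi M)
      \/ phi M = #|ground M|.
  case=> // phiE; exists s0 => //; apply/eqP; rewrite eqn_leq phi_le // andbT.
  by rewrite phiE; apply: leq_trans ss0; rewrite -[leqRHS]card_ord max_card.
rewrite /phi; elim/big_ind: _ => [|x y|s es]; first by right.
- by case: leqP.
- by left; exists s.
Qed.

Lemma dependent_circuit M (X : {set T}) :
  X \subset ground M -> ~~ indep M X -> exists2 C, circuit M C & C \subset X.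
Proof.
move=> XE dX.
have [|C cC CX] := @minset_exists _
  (fun Y : {set T} => (Y \subset ground M) && ~~ indep M Y) X.
  by rewrite XE.
by exists C.
Qed.

Lemma connected_has_circuit M : connected M ->
  ~ isomorphic M (uniform 1 1) -> exists C, circuit M C.
Proof.
case=> /set0Pn[e eE] conn nU; have [E1|[f fE ef]] :
    ground M = [set e] \/ exists2 f, f \in ground M & e != f.
- have [/eqP|/set0Pn[f]] := eqVneq (ground M :\ e) set0.
  + by rewrite setD_eq0 => sE; left; apply/eqP; rewrite eqEsubset sE sub1set.
  + by rewrite !inE => /andP[fe fE]; right; exists f; rewrite // eq_sym.
- have [iE|/(dependent_circuit (subxx _))[C]] := boolP (indep M (ground M));
    last by exists C.
  case: nU; have o0 : ord0 \in ground (uniform 1 1) by rewrite inE.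
  exists (fun=> exist _ ord0 o0); split.
    exists (fun=> exist _ e eE) => [[x xE]|[x xE]]; apply: val_inj => /=.
      by move: xE; rewrite E1 inE => /eqP.
    by rewrite (ord1 x).
  move=> X; rewrite (_ : indep M _ = true); last first.
    by apply: indep_sub iE; apply/subsetP => _ /imsetP[x _ ->]; apply: valP.
  by rewrite /= /uniform_indep (leq_trans (max_card _)) // card_ord.
- by have [C []] := conn e f eE fE ef; exists C.
Qed.

Lemma ear_decomposition_exists M : connected M ->
  ~ isomorphic M (uniform 1 1) -> exists s, ear_decomposition M s.
Proof.
move=> Mc nU; have [C0 cC0] := connected_has_circuit Mc nU; case: Mc => _ conn.
pose good s := [&& s != [::], all (circuit M) s
  & [forall i : 'I_(size s),
      (0 < i) ==> is_ear M (covered s i) (nth set0 s i)]].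
suff H : forall k s, good s -> #|ground M :\: covered s (size s)| <= k ->
    exists s', ear_decomposition M s'.
  apply: (H _ [:: C0] _ (leqnn _)).
  by rewrite /good /= cC0; apply/forallP => -[[|]].
have sub_E s : all (circuit M) s -> covered s (size s) \subset ground M.
  rewrite /covered take_size => /allP cs; rewrite bigcup_seq.
  by apply/bigcupsP => C /cs/minsetP[/andP[]].
elim=> [|k IHk] s gs; have /and3P[s0 cs es] := gs;
  have sE := sub_E s cs.
  rewrite leqn0 cards_eq0 setD_eq0 => Es; exists s.
  by rewrite /ear_decomposition s0 cs es eqEsubset sE Es.
have [/eqP|/set0Pn[f]] := eqVneq (ground M :\: covered s (size s)) set0.
  rewrite setD_eq0 => Es _; exists s.
  by rewrite /ear_decomposition s0 cs es eqEsubset sE Es.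
rewrite inE => /andP[fD fE] lek; set D := covered s (size s) in sE fD lek.
have [e eD] : exists e, e \in D.
  case: s s0 cs {gs es sE fD lek IHk} @D => // C s _ /=/andP[cC _].
  have /set0Pn[e eC] := circuit_neq0 cC; exists e.
  by rewrite /covered /= take_size big_cons inE eC.
have [C [cC eC fC]] := conn e f (subsetP sE e eD) fE
  (contraNneq (fun ef => eq_ind e (fun x => x \in D) eD f ef) fD).
pose P C := [&& circuit M C, C :&: D != set0 & C :\: D != set0].
have PC : P C.
  apply/and3P; split=> //; apply/set0Pn; [exists e|exists f].
    by rewrite inE eC.
  by rewrite inE fD.
case: (arg_minnP (fun C => #|C :\: D|) PC) => C1 PC1 minC1.
have /and3P[cC1 C1D C1D'] := PC1.
have cov : covered (rcons s C1) (size (rcons s C1)) = D :|: C1.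
  by rewrite /D /covered !take_size -cats1 big_cat /= big_seq1.
apply: (IHk (rcons s C1)).
  apply/and3P; split; first by case: (s).
    by rewrite all_rcons cC1 cs.
  apply/forallP => -[i /=]; rewrite size_rcons ltnS leq_eqVlt => lti.
  have covi : covered (rcons s C1) i = covered s i.
    rewrite /covered -cats1 takel_cat //.
    by case/orP: lti => [/eqP->|/ltnW].
  apply/implyP => i0; rewrite covi nth_rcons.
  case/orP: lti => [/eqP ->|lti].
    rewrite ltnn eqxx; apply/and3P; split=> //; apply/forallP => C2.
    apply/implyP => PC2; apply: contraL (minC1 _ PC2) => /proper_card.
    by rewrite -ltnNge.
  by rewrite lti; have /forallP/(_ (Ordinal lti))/implyP/(_ i0) := es.
rewrite cov -ltnS; apply: leq_trans lek; apply: proper_card.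
rewrite properE setDS ?subsetUl //=; have /set0Pn[x] := C1D'.
rewrite inE => /andP[xD xC1]; apply/subsetPn; exists x.
  rewrite inE xD; have /minsetP[/andP[/subsetP C1E _] _] := cC1.
  exact: C1E.
by rewrite !inE xC1 orbT.
Qed.

End PhiSpec.

(* Main.v *)
Require Import Defs.
From mathcomp Require Import all_boot all_order all_algebra.
From mathcomp Require Import zify.

(** For a binary matroid, fix a representing family [v] over GF(2) and call two
    subsets of the ground set equivalent when their columns have the same sum,
    that is, when their symmetric difference lies in the cycle space. (In a
    graph, the classes are the sets of T-joins, one for each T.)

    A join [J] is a smallest set of its class: an element of the cycle space is
    a disjoint union of circuits, and [J] contains at most half of each of them
    ([join_null_set]), so that exchanging [J] along it cannot shrink [J]
    ([join_minimum]).

    Conversely every class has a small member, built lobe by lobe along an ear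
    decomposition. Adding the circuit [C_i] complements a set inside the lobe
    [P_i], so some member of the class has at most [|P_i| / 2] rounded down
    elements in [P_i]; the rest lives in [D_(i-1)] and is treated by induction.
    As the [i]th lobe raises the rank by at least [|P_i| - 1]
    ([indep_setU_lobe]), twice the number of elements spent on it is at most
    the rank increase, plus one if the lobe is even. Hence every class has a
    member of size at most half the sum of the rank and the number of even lobes
    ([ear_decomposition_small_representative]), and a decomposition with the
    fewest even lobes gives the bound. *)

Set Implicit Arguments.
Unset Strict Implicit.
Unset Printing Implicit Defensive.

Import GRing.Theory Num.Theory.

Definition symdiff (T : finType) (X Y : {set T}) : {set T} :=
  (X :\: Y) :|: (Y :\: X).

Lemma F2_scale (V : lmodType 'F_2) (c : 'F_2) (x : V) :
  (c *: x = if c != 0 then x else 0)%R.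
Proof.
case: eqVneq => [->|c0]; first exact: scale0r.
have -> : c = 1%R; last exact: scale1r.
by case: c c0 => -[|[|k]] //= lt_k _; apply: val_inj.
Qed.

Lemma F2_addvv (V : lmodType 'F_2) (x : V) : (x + x = 0)%R.
Proof. by rewrite -[x in LHS]scale1r -scalerDl F2_scale. Qed.

Lemma sum_setU_disjoint (T : finType) (V : nmodType) (v : T -> V)
    (X Y : {set T}) : [disjoint X & Y] ->
  (\sum_(e in X :|: Y) v e = \sum_(e in X) v e + \sum_(e in Y) v e)%R.
Proof.
by move=> disjXY; rewrite -bigU //=; apply: eq_bigl => e; rewrite !inE.
Qed.

Lemma F2_sum_symdiff (T : finType) (V : lmodType 'F_2) (v : T -> V)
    (X Y : {set T}) :
  (\sum_(e in symdiff X Y) v e = \sum_(e in X) v e + \sum_(e in Y) v e)%R.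
Proof.
rewrite [in RHS](big_setID Y) /= [X in (_ = _ + X)%R](big_setID X) /=.
rewrite [Y :&: X]setIC addrACA F2_addvv add0r sum_setU_disjoint //.
by rewrite -setI_eq0; apply/eqP/setP => e; rewrite !inE; case: (e \in X);
  rewrite ?andbF.
Qed.

(** Over GF(2) a linear relation is determined by its support. *)
Lemma F2_freeP (T : finType) (V : vectType 'F_2) (v : T -> V) (X : {set T}) :
  reflect (forall S : {set T}, S \subset X ->
             (\sum_(e in S) v e)%R = 0%R -> S = set0)
          (free [seq v e | e in X]).
Proof.
have nthE (i : 'I_#|X|) : ([seq v e | e in X]`_i)%R = v (enum_val i).
  by rewrite (nth_image 0%R).
apply: (iffP (@freeP _ _ _ (image_tuple v X))) => [freeX S sSX S0|nullX k k0 i].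
- apply/eqP; apply: contraT => /set0Pn[e eS]; have eX := subsetP sSX e eS.
  have := freeX (fun i => if enum_val i \in S then 1 else 0)%R.
  move=> /(_ _ (enum_rank_in eX e)); rewrite enum_rankK_in // eS => k0.
  suff /k0/eqP : (\sum_(i < #|X|) (if enum_val i \in S then 1 else 0) *:
      (image_tuple v X)`_i)%R = 0%R by rewrite oner_eq0.
  rewrite -[RHS]S0 -[in RHS](setIidPr sSX).
  rewrite (eq_bigl _ _ (fun e => in_setI e X S)) big_mkcondr.
  rewrite [RHS]big_enum_val /=; apply: eq_bigr => i _.
  by rewrite nthE; case: ifP; rewrite ?scale1r ?scale0r.
- apply/eqP; apply: contraT => ki.
  suff /setP/(_ (enum_val i)) : enum_val @: [set j | k j != 0%R] = set0.
    by rewrite imset_f ?inE.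
  apply: nullX; first by apply/subsetP => _ /imsetP[j _ ->]; apply: enum_valP.
  rewrite big_imset /=; last by move=> ? ? _ _; apply: enum_val_inj.
  rewrite -[RHS]k0 big_mkcond /=; apply: eq_bigr => j _.
  by rewrite inE F2_scale nthE.
Qed.

(** A circuit inside the enlarged set is not contained in [B], nor properly
    contained in [C], so it meets both [D] and its complement. Its part outside
    [D] misses [e], so it is a proper subset of the lobe [C :\: D], against the
    minimality of the lobe. The alternative [D = set0] serves the first circuit
    of an ear decomposition. *)
Lemma indep_setU_lobe (T : finType) (M : matroid T) (B C D : {set T}) (e : T) :
  circuit M C -> D = set0 \/ is_ear M D C -> indep M B -> B \subset D ->
  e \in C :\: D -> indep M (B :|: (C :\: D) :\ e).
Proof.
move=> cC earC iB BD eP; apply: contraT => dX.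
have /minsetP[/andP[CE _] minC] := cC.
have sXE : B :|: (C :\: D) :\ e \subset ground M.
  rewrite subUset (indep_sub_ground iB) /=.
  by rewrite (subset_trans (subsetDl _ _)) // (subset_trans (subsetDl _ _)).
have [C' cC' sC'X] := dependent_circuit sXE dX.
have /minsetP[/andP[C'E dC'] _] := cC'.
have ltP : C' :\: D \proper C :\: D.
  apply: sub_proper_trans (properD1 eP); apply/subsetP => f.
  rewrite inE => /andP[fD /(subsetP sC'X)]; rewrite inE => /orP[|//].
  by move/(subsetP BD); rewrite (negPf fD).
have C'D : C' :&: D = set0.
  case: earC => [->|/and3P[_ _ /forallP/(_ C')/implyP minP]].
    by rewrite setI0.
  apply/eqP; apply: contraT => C'Dn0; have/negP[] := dC'.
  apply: indep_sub iB; apply/subsetP => f fC'.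
  have : C' :\: D == set0.
    by apply: contraT => C'Pn0; have := minP (introT and3P _); rewrite ltP;
      move=> /(_ (And3 cC' C'Dn0 C'Pn0)).
  rewrite setD_eq0 => /subsetP/(_ f fC') fD.
  by have := subsetP sC'X f fC'; rewrite !inE fD /= andbF orbF.
have C'DE : C' :\: D = C' by rewrite -[RHS](setID C' D) C'D set0U.
rewrite C'DE in ltP.
have C'C : C' = C.
  by apply: minC; rewrite ?C'E // (subset_trans (proper_sub ltP)) // subsetDl.
by move: ltP; rewrite properE {2}C'C subsetDl andbF.
Qed.

Section Represented.

Variables (T : finType) (M : matroid T) (V : vectType 'F_2) (v : T -> V).
Hypothesis repr : forall X : {set T}, X \subset ground M ->
  indep M X = free [seq v e | e in X].

(** The support of a nontrivial relation among the columns of a circuit is a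
    dependent subset, hence the whole circuit. *)
Lemma circuit_sum0 (C : {set T}) : circuit M C -> (\sum_(e in C) v e = 0)%R.
Proof.
case/minsetP=> /andP[CE]; rewrite repr // => /F2_freeP dC minC.
apply/eqP; apply: contraT => C0; case: dC => S sSC S0.
apply/eqP; apply: contraT => Sn0.
have SC : S = C.
  apply: minC => //; rewrite (subset_trans sSC) //= repr ?(subset_trans sSC) //.
  by apply/F2_freeP => /(_ S (subxx _) S0)/eqP; apply/negP.
by rewrite -SC S0 eqxx in C0.
Qed.

(** Peeling off circuits one at a time decomposes [S] into disjoint circuits. *)
Lemma join_null_set (J S : {set T}) : is_join M J -> S \subset ground M ->
  (\sum_(e in S) v e = 0)%R -> 2 * #|J :&: S| <= #|S|.
Proof.
case/andP=> _ /forallP joinJ.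
have [n] := ubnP #|S|; elim: n S => // n IHn S ltSn SE S0.
have [->|Sn0] := eqVneq S set0; first by rewrite setI0 cards0.
have dS : ~~ indep M S.
  by rewrite repr //; apply/F2_freeP => /(_ S (subxx _) S0)/eqP; apply/negP.
have [C cC sCS] := dependent_circuit SE dS.
have Cpos : 0 < #|C| by rewrite card_gt0 (circuit_neq0 cC).
have cardS : #|S| = #|C| + #|S :\: C| by rewrite -(cardsID C) (setIidPr sCS).
have cardJS : #|J :&: S| = #|J :&: C| + #|J :&: (S :\: C)|.
  by rewrite -(cardsID C) -setIA (setIidPr sCS) setIDA.
rewrite cardS cardJS mulnDr leq_add //.
  by have /implyP/(_ cC) := joinJ C.
apply: IHn.
- by move: ltSn Cpos; rewrite cardS; lia.
- by rewrite (subset_trans _ SE) // subsetDl.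
- move: S0; rewrite (big_setID C) /= (setIidPr sCS).
  by rewrite circuit_sum0 // add0r.
Qed.

Lemma join_minimum (J X : {set T}) : is_join M J -> X \subset ground M ->
  (\sum_(e in X) v e = \sum_(e in J) v e)%R -> #|J| <= #|X|.
Proof.
move=> joinJ XE eqXJ; have /andP[JE _] := joinJ.
have := join_null_set joinJ (_ : symdiff J X \subset ground M).
rewrite F2_sum_symdiff eqXJ F2_addvv.
rewrite subUset !(subset_trans (subsetDl _ _)) // => /(_ isT erefl).
have -> : J :&: symdiff J X = J :\: X.
  apply/setP => e; rewrite !inE.
  by case: (e \in J); rewrite ?andbF ?andbT ?orbF.
rewrite /symdiff cardsU (_ : _ :&: _ = set0) ?cards0 ?subn0; last first.
  by apply/setP => e; rewrite !inE; case: (e \in J); rewrite ?andbF.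
rewrite mul2n -addnn leq_add2l => leJX.
by rewrite -(cardsID X J) -(cardsID J X) setIC leq_add2l.
Qed.

(** The set [B] is a witness for the rank reached by the first [i] circuits. It
    is quantified before [X] because the same [B] must serve all classes and be
    extended, lobe after lobe, to one independent set of [M]. *)
Lemma ear_prefix_small_representative (s : seq {set T}) (i : nat) :
  ear_decomposition M s -> i <= size s ->
  exists B : {set T}, [/\ indep M B, B \subset covered s i
    & forall X : {set T}, X \subset covered s i ->
      exists Y : {set T}, [/\ Y \subset covered s i,
        (\sum_(e in Y) v e = \sum_(e in X) v e)%R
        & 2 * #|Y| <= #|B| + \sum_(j < i) ~~ odd #|lobe s j| ]].
Proof.
case/and4P=> _ /allP cs _ /forallP ears.
elim: i => [|i IHi] lti.
  exists set0; rewrite indep0 sub0set; split=> // X sX; exists X.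
  split=> //; move: sX; rewrite /covered take0 big_nil subset0 => /eqP->.
  by rewrite cards0.
have [B [iB BD smallB]] := IHi (ltnW lti).
set D := covered s i in BD smallB *; pose C := nth set0 s i; pose P := C :\: D.
have cC : circuit M C by apply: cs; rewrite mem_nth.
have DP_C : D :|: P = D :|: C.
  by apply/setP => f; rewrite !inE; case: (f \in D).
have DS : covered s i.+1 = D :|: P by rewrite coveredS // DP_C.
have earC : D = set0 \/ is_ear M D C.
  rewrite /D /C; case: (i) (lti) => [|k] ltk.
    by left; rewrite /covered take0 big_nil.
  by right; have /implyP := ears (Ordinal ltk); apply.
have [e eP] : exists e, e \in P.
  apply/set0Pn; case: earC => [D0|/and3P[] //].
  by rewrite /P D0 setD0 (circuit_neq0 cC).
have Bdisj : #|B :|: P :\ e| = #|B| + #|P :\ e|.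
  rewrite cardsU (_ : _ :&: _ = set0) ?cards0 ?subn0 //.
  apply/setP => f; rewrite !inE; apply/negbTE/negP.
  by case/andP=> /(subsetP BD) ->; rewrite andbF.
have cardP := cardsD1 e P; rewrite eP in cardP.
exists (B :|: P :\ e); split.
- exact: indep_setU_lobe.
- by rewrite DS setUSS // subsetDl.
rewrite DS => X sX.
(* Since [P \subset C], exchanging along [C] complements [X] inside [P]. *)
have [X' [sX' eqX' leX']] : exists X' : {set T}, [/\ X' \subset D :|: P,
    (\sum_(e in X') v e = \sum_(e in X) v e)%R & #|X' :&: P| <= #|P|./2].
  have [leX|gtX] := leqP #|X :&: P| #|P|./2; first by exists X.
  exists (symdiff X C); split.
  + rewrite subUset !(subset_trans (subsetDl _ _)) //.
    by rewrite DP_C subsetUr.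
  + by rewrite F2_sum_symdiff (circuit_sum0 cC) addr0.
  + have -> : symdiff X C :&: P = P :\: X.
      apply/setP => f; rewrite !inE.
      by case: (f \in X); case: (f \in C); case: (f \in D).
    have := cardsID X P; rewrite setIC; move: gtX.
    rewrite -{2 3}[#|P|]odd_double_half -addnn; lia.
have DP : [disjoint D & P] by rewrite -setI_eq0 setIDA setDIl setDv set0I.
have [Y [sY eqY leY]] := smallB (X' :&: D) (subsetIr _ _).
exists (Y :|: (X' :&: P)); split.
- by rewrite setUSS // subsetIr.
- rewrite sum_setU_disjoint ?(disjointW sY (subsetIr _ _) DP) // eqY -eqX'.
  rewrite -sum_setU_disjoint ?(disjointW (subsetIr _ _) (subsetIr _ _) DP) //.
  by rewrite -setIUr (setIidPl sX').
have leYU : #|Y :|: X' :&: P| <= #|Y| + #|X' :&: P| by apply: leq_card_setU.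
rewrite Bdisj big_ord_recr /= -[lobe s i]/P.
move: leX' leY leYU cardP; have := odd_double_half #|P|; rewrite -addnn.
set E := (\sum_(_ < i) _); case: odd => /=; lia.
Qed.

Lemma ear_decomposition_small_representative (s : seq {set T}) (X : {set T}) :
  ear_decomposition M s -> X \subset ground M ->
  exists Y : {set T}, [/\ Y \subset ground M,
    (\sum_(e in Y) v e = \sum_(e in X) v e)%R
    & 2 * #|Y| <= rank M + even_lobes s].
Proof.
move=> ears; have /and4P[_ _ /eqP covE _] := ears.
have [B [iB _ small]] := ear_prefix_small_representative ears (leqnn _).
rewrite covE in small => /small[Y [sY eqY leY]]; exists Y; split=> //.
apply: leq_trans leY _; apply: leq_add.
  exact: (@leq_bigmax_cond _ (indep M) (fun X : {set T} => #|X|)).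
rewrite /even_lobes -sum1_card [leqRHS]big_mkcond; apply: leq_sum => j _.
by rewrite inE; case: odd.
Qed.

End Represented.

Theorem theorem4p3 (T : finType) (M : matroid T)
  (hconn : connected M) (hbin : binary M)
  (hU11 : ~ isomorphic M (uniform 1 1)) :
  ((mu M)%:R <= eta M :> rat)%R.
Proof.
have [m [v repr]] := hbin.
have [s0 ears0] := ear_decomposition_exists hconn hU11.
have [s ears phiE] := phi_attained ears0.
rewrite /eta ler_pdivlMr ?ltr0n // -natrM ler_nat mulnC -phiE.
suff le_mu J : is_join M J -> 2 * #|J| <= rank M + even_lobes s.
  rewrite /mu; elim/big_ind: _ => [//|x y lex ley|J /le_mu //].
  by rewrite maxnMr geq_max lex.
move=> joinJ; have /andP[JE _] := joinJ.
have [Y [YE eqY leY]] := ear_decomposition_small_representative repr ears JE.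
by apply: leq_trans leY; rewrite leq_mul2l (join_minimum repr joinJ YE eqY).
Qed.
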